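(* Let $n$ and $w$ be integers such that $n\geq 2$ and $2\leq 2w\leq n-1$. The set of $n\times n$ complex skew-symmetric matrix pencils with rank at most $2w$ is a closed subset of $\mathrm{PENCIL}^{ss}_{n\times n}$ equal to $\overline{\mathrm{O}^c}(\mathcal{W})$, where $$\mathcal{W}=\mathrm{diag}(\underbrace{\mathcal{M}_{\alpha+1},\dots,\mathcal{M}_{\alpha+1}}_{s},\underbrace{\mathcal{M}_{\alpha},\dots,\mathcal{M}_{\alpha}}_{n-2w-s})$$ with $\alpha=\lfloor w/(n-2w)\rfloor$ and $s=w \bmod (n-2w)$.
   Context: A matrix pencil is $\lambda A-B$ with $A,B$ complex matrices of the same size; it is skew-symmetric if $A^T=-A$ and $B^T=-B$. $\mathrm{PENCIL}^{ss}_{n\times n}$ is the vector space of all $n\times n$ complex skew-symmetric matrix pencils, a metric space with distance $d(\lambda A-B,\lambda C-D)=\sqrt{\|A-C\|_F^2+\|B-D\|_F^2}$ ($\|\cdot\|_F$ the Frobenius norm); closures and closed sets are with respect to this metric. The rank of a pencil is the largest size of a minor that is not the identically zero scalar polynomial in $\lambda$ (its rank over $\mathbb{C}(\lambda)$). The congruence orbit of a skew-symmetric $n\times n$ pencil is $\mathrm{O}^c(\lambda A-B)=\{S^T(\lambda A-B)S : S\in GL_n(\mathbb{C})\}$, and $\overline{\mathrm{O}^c}(\lambda A-B)$ is its closure in $\mathrm{PENCIL}^{ss}_{n\times n}$. For $k=0,1,2,\dots$ let $F_k$ and $G_k$ be the $k\times(k+1)$ matrices whose only non-zero entries are $(F_k)_{i,i+1}=1$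 and $(G_k)_{i,i}=1$ for $i=1,\dots,k$, i.e. $F_k=[\,0\ \ I_k\,]$ and $G_k=[\,I_k\ \ 0\,]$. Then $\mathcal{M}_k$ is the $(2k+1)\times(2k+1)$ skew-symmetric pencil $$\mathcal{M}_k:=\lambda\begin{bmatrix}0&G_k\\-G_k^T&0\end{bmatrix}-\begin{bmatrix}0&F_k\\-F_k^T&0\end{bmatrix},$$ with $\mathcal{M}_0$ the $1\times1$ zero pencil. $\mathrm{diag}(\cdot)$ denotes the block-diagonal direct sum. *)

(* Defs.v *)
From HB Require Import structures.
From mathcomp Require Import all_boot all_order all_algebra.
From mathcomp Require Import complex ring zify.
From mathcomp Require Import all_classical all_reals all_analysis.

Set Implicit Arguments.
Unset Strict Implicit.
Unset Printing Implicit Defensive.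

Import Order.TTheory GRing.Theory Num.Theory.

Local Open Scope classical_set_scope.
Local Open Scope complex_scope.
Local Open Scope ring_scope.

Section L2.
Context {R : realType} {I : finType}.
Implicit Types a b : I -> R.

Lemma l2_cauchy_schwarz a b :
  \sum_i a i * b i <=
    Num.sqrt (\sum_i a i ^+ 2) * Num.sqrt (\sum_i b i ^+ 2).
Proof.
set A := \sum_i a i ^+ 2; set B := \sum_i b i ^+ 2.
have A0 : 0 <= A by apply: sumr_ge0 => i _; exact: sqr_ge0.
have B0 : 0 <= B by apply: sumr_ge0 => i _; exact: sqr_ge0.
set x := Num.sqrt A; set y := Num.sqrt B.
have xE : x ^+ 2 = A by rewrite sqr_sqrtr.
have yE : y ^+ 2 = B by rewrite sqr_sqrtr.
have x0 : 0 <= x by exact: sqrtr_ge0.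
have y0 : 0 <= y by exact: sqrtr_ge0.
have zero (f : I -> R) : \sum_i f i ^+ 2 = 0 -> forall i, f i = 0.
  move=> f0 i; apply/eqP; rewrite -sqrf_eq0; apply/eqP.
  by apply: (psumr_eq0P _ f0) => // j _; exact: sqr_ge0.
have [xz|xn] := eqVneq x 0.
  rewrite xz mul0r big1// => i _; rewrite zero ?mul0r//.
  by rewrite -/A -xE xz expr0n.
have [yz|yn] := eqVneq y 0.
  rewrite yz mulr0 big1// => i _; rewrite (zero b) ?mulr0//.
  by rewrite -/B -yE yz expr0n.
have xy0 : 0 < x * y by rewrite mulr_gt0// lt0r ?xn ?yn.
have : 0 <= \sum_i (y * a i - x * b i) ^+ 2.
  by apply: sumr_ge0 => i _; exact: sqr_ge0.
have -> : \sum_i (y * a i - x * b i) ^+ 2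
    = y ^+ 2 * A + x ^+ 2 * B - (x * y * \sum_i a i * b i) *+ 2.
  rewrite -mulrnAl !mulr_sumr -big_split -sumrB /=.
  by apply: eq_bigr => i _; ring.
rewrite -xE -yE [y ^+ 2 * _]mulrC -mulr2n -mulrnBl pmulrn_lge0// subr_ge0.
by rewrite -exprMn expr2 ler_pM2l.
Qed.

Lemma l2_triangle a b :
  Num.sqrt (\sum_i (a i + b i) ^+ 2) <=
    Num.sqrt (\sum_i a i ^+ 2) + Num.sqrt (\sum_i b i ^+ 2).
Proof.
have s0 (f : I -> R) : 0 <= \sum_i f i ^+ 2.
  by apply: sumr_ge0 => i _; exact: sqr_ge0.
rewrite -[leRHS]ger0_norm ?addr_ge0 ?sqrtr_ge0// -sqrtr_sqr.
apply: ler_wsqrtr; rewrite sqrrD !sqr_sqrtr//.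
under eq_bigr do rewrite sqrrD.
rewrite !big_split/= lerD2r lerD2l mulr2n.
by apply: lerD; exact: l2_cauchy_schwarz.
Qed.

End L2.

Section Frobenius.
Context {R : realType} {n : nat}.
Implicit Types A B : 'M[R[i]]_n.

Definition frobenius A : R :=
  Num.sqrt (\sum_i \sum_j Normc.normc (A i j) ^+ 2).

Lemma frobenius_pair A : frobenius A =
  Num.sqrt (\sum_(p : 'I_n * 'I_n) Normc.normc (A p.1 p.2) ^+ 2).
Proof. by rewrite /frobenius pair_bigA. Qed.

Lemma frobenius_ge0 A : 0 <= frobenius A.
Proof. exact: sqrtr_ge0. Qed.

Lemma frobenius0 : frobenius 0 = 0.
Proof.
rewrite frobenius_pair big1 ?sqrtr0// => p _.
by rewrite mxE Normc.normc0 expr0n.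
Qed.

Lemma frobenius_eq0 A : frobenius A = 0 -> A = 0.
Proof.
rewrite frobenius_pair => /eqP; rewrite sqrtr_eq0 => le0.
have s0 : \sum_(p : 'I_n * 'I_n) Normc.normc (A p.1 p.2) ^+ 2 = 0.
  by apply/eqP; rewrite eq_le le0/= sumr_ge0// => p _; exact: sqr_ge0.
apply/matrixP => i j; rewrite mxE; apply: Normc.eq0_normc; apply/eqP.
rewrite -sqrf_eq0; apply/eqP.
have := @psumr_eq0P _ _ _ _ (fun p _ => sqr_ge0 (Normc.normc (A p.1 p.2))) s0.
by move=> /(_ (i, j) isT).
Qed.

Lemma frobeniusN A : frobenius (- A) = frobenius A.
Proof.
by rewrite !frobenius_pair; under eq_bigr do rewrite mxE normcN.
Qed.

Lemma frobeniusD A B : frobenius (A + B) <= frobenius A + frobenius B.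
Proof.
rewrite !frobenius_pair; apply: le_trans (l2_triangle _ _).
apply: ler_wsqrtr; apply: ler_sum => p _; rewrite mxE.
have nc0 (z : R[i]) : 0 <= Normc.normc z by case: z => ? ?; exact: sqrtr_ge0.
by rewrite lerXn2r ?nnegrE ?addr_ge0//; exact: le_normcD.
Qed.

End Frobenius.

Section SkewPencil.
Context {R : realType}.

(* The pair (A, B) stands for the pencil X A - B. *)
Definition is_skew_pencil n (P : 'M[R[i]]_n * 'M[R[i]]_n) : bool :=
  (P.1^T == - P.1) && (P.2^T == - P.2).

Record skew_pencil n := SkewPencil {
  pencil_val : 'M[R[i]]_n * 'M[R[i]]_n;
  pencil_valP : is_skew_pencil pencil_val }.

HB.instance Definition _ n := [isSub for @pencil_val n].
HB.instance Definition _ n := [Choice of skew_pencil n by <:].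

Definition pencil_dist n (P Q : skew_pencil n) : R :=
  Num.sqrt (frobenius ((pencil_val P).1 - (pencil_val Q).1) ^+ 2
          + frobenius ((pencil_val P).2 - (pencil_val Q).2) ^+ 2).

Lemma pencil_distxx n (P : skew_pencil n) : pencil_dist P P = 0.
Proof. by rewrite /pencil_dist !subrr frobenius0 expr0n addr0 sqrtr0. Qed.

Lemma pencil_dist_positivity n (P Q : skew_pencil n) :
  pencil_dist P Q = 0 -> P = Q.
Proof.
move=> /eqP; rewrite sqrtr_eq0 => le0.
have : frobenius ((pencil_val P).1 - (pencil_val Q).1) ^+ 2
     + frobenius ((pencil_val P).2 - (pencil_val Q).2) ^+ 2 == 0.
  by rewrite eq_le le0 addr_ge0 ?sqr_ge0.
rewrite paddr_eq0 ?sqr_ge0// !sqrf_eq0 => /andP[/eqP e1 /eqP e2].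
apply: val_inj; apply: injective_projections; apply/eqP; rewrite -subr_eq0.
  by apply/eqP; exact: frobenius_eq0.
by apply/eqP; exact: frobenius_eq0.
Qed.

Lemma pencil_dist_sym n (P Q : skew_pencil n) :
  pencil_dist P Q = pencil_dist Q P.
Proof.
by rewrite /pencil_dist -frobeniusN opprB -[frobenius (_.2 - _)]frobeniusN opprB.
Qed.

Lemma pencil_dist_triangle n (Q P S : skew_pencil n) :
  pencil_dist P S <= pencil_dist P Q + pencil_dist Q S.
Proof.
pose c (A B : skew_pencil n) (b : bool) := frobenius
  (if b then (pencil_val A).1 - (pencil_val B).1
   else (pencil_val A).2 - (pencil_val B).2).
have dE A B : pencil_dist A B = Num.sqrt (\sum_b c A B b ^+ 2).
  by rewrite big_bool.
rewrite !dE; apply: le_trans (l2_triangle _ _); apply: ler_wsqrtr.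
apply: ler_sum => b _; rewrite lerXn2r ?nnegrE ?addr_ge0 ?frobenius_ge0//.
apply: le_trans (frobeniusD _ _); rewrite le_eqVlt; apply/orP; left.
by apply/eqP; congr frobenius; case: b; rewrite addrA subrK.
Qed.

HB.instance Definition _ n := @isMetric.Build R (skew_pencil n)
  (@pencil_dist n) (@pencil_distxx n) (@pencil_dist_positivity n)
  (@pencil_dist_sym n) (@pencil_dist_triangle n).

Definition pencil_mx n (P : skew_pencil n) : 'M[{poly R[i]}]_n :=
  'X *: map_mx polyC (pencil_val P).1 - map_mx polyC (pencil_val P).2.

Definition incr_ord k n (f : 'I_k -> 'I_n) : bool :=
  [forall i : 'I_k, forall j : 'I_k, (i < j)%N ==> (f i < f j)%N].

(* Order 0 is allowed: the empty minor is 1, so the zero pencil has rank 0. *)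
Definition pencil_rank n (P : skew_pencil n) : nat :=
  \max_(k < n.+1 |
      [exists f : {ffun 'I_k -> 'I_n}, exists g : {ffun 'I_k -> 'I_n},
        [&& incr_ord f, incr_ord g & \det (mxsub f g (pencil_mx P)) != 0]]) k.

Definition congruence_orbit n (P : skew_pencil n) : set (skew_pencil n) :=
  [set Q | exists2 S : 'M[R[i]]_n, S \in unitmx &
     pencil_val Q = (S^T *m (pencil_val P).1 *m S,
                     S^T *m (pencil_val P).2 *m S)].

Definition Fmx k : 'M[R[i]]_(k, k.+1) := \matrix_(i, j) (j == i.+1 :> nat)%:R.
Definition Gmx k : 'M[R[i]]_(k, k.+1) := \matrix_(i, j) (j == i :> nat)%:R.

Lemma skew_block k (A : 'M[R[i]]_(k, k.+1)) :
  (block_mx 0 A (- A^T) 0)^T = - block_mx 0 A (- A^T) 0.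
Proof.
by rewrite tr_block_mx opp_block_mx !trmx0 !oppr0 opprK linearN /= trmxK.
Qed.

Lemma Mpencil_subproof k : is_skew_pencil
  (block_mx 0 (Gmx k) (- (Gmx k)^T) 0, block_mx 0 (Fmx k) (- (Fmx k)^T) 0).
Proof. by rewrite /is_skew_pencil !skew_block !eqxx. Qed.

Definition Mpencil k : skew_pencil (k + k.+1) :=
  SkewPencil (Mpencil_subproof k).

Lemma diag_pencil_subproof m (p : 'I_m -> nat)
    (P : forall i, skew_pencil (p i)) : is_skew_pencil
  (\mxdiag_i (pencil_val (P i)).1, \mxdiag_i (pencil_val (P i)).2).
Proof.
rewrite /is_skew_pencil /= !tr_mxdiag -!mxdiagN.
by apply/andP; split; apply/eqP; apply: eq_mxdiag => i;
  case/andP: (pencil_valP (P i)) => /eqP ? /eqP.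
Qed.

Definition diag_pencil m (p : 'I_m -> nat) (P : forall i, skew_pencil (p i)) :
    skew_pencil (\sum_i p i) :=
  SkewPencil (diag_pencil_subproof P).

Lemma cast_pencil_subproof m n (e : m = n) (P : skew_pencil m) : is_skew_pencil
  (castmx (e, e) (pencil_val P).1, castmx (e, e) (pencil_val P).2).
Proof. by case: n / e; rewrite !castmx_id -surjective_pairing pencil_valP. Qed.

Definition cast_pencil m n (e : m = n) (P : skew_pencil m) : skew_pencil n :=
  SkewPencil (cast_pencil_subproof e P).

(* The n - 2w blocks: s copies of M_(alpha+1), then n - 2w - s of M_alpha. *)
Definition Windex n w (i : nat) : nat :=
  let alpha := (w %/ (n - 2 * w))%N in
  let s := (w %% (n - 2 * w))%N in
  if (i < s)%N then alpha.+1 else alpha.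

Lemma Wsize n w : (2 <= 2 * w <= n - 1)%N ->
  (\sum_(i < n - 2 * w) (Windex n w i + (Windex n w i).+1))%N = n.
Proof.
move=> /andP[w2 wn].
have nw : (2 * w + (n - 2 * w) = n)%N by lia.
have d0 : (0 < n - 2 * w)%N by lia.
set d := (n - 2 * w)%N in nw d0 *.
have sd : (w %% d <= d)%N by rewrite ltnW// ltn_mod.
rewrite -[RHS]nw [in RHS](divn_eq w d).
transitivity (\sum_(i < d) (2 * (w %/ d) + 1 + 2 * (i < w %% d)))%N.
  apply: eq_bigr => i _; rewrite /Windex -/d.
  by case: ifP => _; lia.
rewrite big_split/= sum_nat_const card_ord -big_distrr/=.
have -> : (\sum_(i < d) (i < w %% d))%N = (w %% d)%N.
  rewrite -big_mkcond/= -(big_mkord (fun i => i < w %% d)%N (fun _ => 1%N)).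
  rewrite -(big_nat_widen 0 _ d xpredT)// sum_nat_const_nat muln1 subn0 //.
by move: (w %/ d)%N (w %% d)%N => a b; rewrite !mulnDr muln1; clear; nia.
Qed.

Definition Wpencil n w (hw : (2 <= 2 * w <= n - 1)%N) : skew_pencil n :=
  cast_pencil (Wsize hw)
    (diag_pencil (fun i : 'I_(n - 2 * w) => Mpencil (Windex n w i))).

End SkewPencil.

Arguments skew_pencil R n : clear implicits.
Arguments Wpencil R {n w} hw.

(* Main.v *)
Require Import Defs.
From HB Require Import structures.
From mathcomp Require Import all_boot all_order all_algebra all_fingroup.
From mathcomp Require Import complex ring zify.
From mathcomp Require Import all_classical all_reals all_analysis.

(** Minors are continuous, so bounding the rank defines a closed set, and it
    contains the orbit of [W]. Conversely, let [lambda A - B] be skew of rank at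
    most [2w]. Every pencil has a vector [x <> 0] with [x A] and [x B] collinear;
    passing to the orthogonal of [x A] and [x B] modulo [x] and inducting, one
    finds an isotropic subspace of dimension [n - w] common to [A] and [B], so
    the pencil is congruent to [[Y, K], [-K^T, 0]] with [K] of size w x (n - w).
    Up to a permutation, [W] is [[0, K0], [-K0^T, 0]] where [K0] is the pencil
    [lambda [I_w 0] - [0 I_w]]. Since (S, T) |-> S K0 - K0 T is onto, the pencil
    [K + t (K0 - K)] is strictly equivalent to [K0] for all but finitely many
    [t]; the block [Y] can then be cleared because every skew pencil has the form
    [K0 Z - (K0 Z)^T] with [Z] constant. So some line through the given pencil
    has all but finitely many of its points in the orbit of [W]. *)

Set Implicit Arguments.
Unset Strict Implicit.
Unset Printing Implicit Defensive.

Import Order.TTheory GRing.Theory Num.Theory.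
Import numFieldNormedType.Exports.

Local Open Scope classical_set_scope.
Local Open Scope complex_scope.
Local Open Scope ring_scope.

(** * Common isotropic subspaces *)

Lemma skew_quad0 (F : numFieldType) n (H : 'M[F]_n) (x : 'rV[F]_n) :
  H^T = - H -> x *m H *m x^T = 0.
Proof.
move=> Hskew; set q := x *m H *m x^T.
have qN : q = - q.
  rewrite -[LHS](_ : q^T = q); last first.
    by apply/matrixP => i j; rewrite mxE !ord1.
  by rewrite /q !trmx_mul trmxK Hskew mulNmx mulmxN mulmxA.
have /eqP : 2%:R *: q = 0 by rewrite scaler_nat mulr2n {1}qN addNr.
by rewrite scaler_eq0 pnatr_eq0/= => /eqP.
Qed.

(** The rank drops twice. With [b = x H], the space [Z] spanned by [b] and the rows of [Q H] lies in
    the row space of [H] and is killed by [x^T], whereas [H x^T <> 0]. Next, [Q^T] kills [b], which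
    lies in [Z], and maps [Z] onto a smaller space containing the rows of [Q H Q^T]. *)
Lemma rank_skew_perp (F : numFieldType) n k (H : 'M[F]_n) (x : 'rV[F]_n)
    (Q : 'M[F]_(k, n)) : H^T = - H -> x *m H != 0 -> Q *m (x *m H)^T = 0 ->
  ((\rank (Q *m H *m Q^T)).+2 <= \rank H)%N.
Proof.
move=> Hskew b0 Qb; set b := x *m H in b0 Qb *.
have bT : H *m x^T = - b^T by rewrite /b trmx_mul Hskew mulNmx opprK.
have bx : b *m x^T = 0 by exact: skew_quad0.
have bQ : b *m Q^T = 0 by rewrite -[LHS]trmxK trmx_mul trmxK Qb trmx0.
set Z := (b + Q *m H)%MS.
have bZ : (b <= Z)%MS by exact: addsmxSl.
have rb : \rank b = 1%N by rewrite rank_rV b0.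
have rZ : (\rank Z < \rank H)%N.
  rewrite -(mxrank_mul_ker H x^T) -[X in (X < _)%N]add0n.
  rewrite -addSn leq_add//.
    by rewrite bT mxrank_opp mxrank_tr rb.
  apply: mxrankS; rewrite sub_capmx addsmx_sub submxMl mulmx_sub//=.
  rewrite addsmx_sub !sub_kermx bx eqxx -mulmxA bT mulmxN Qb oppr0 eqxx//.
apply: leq_ltn_trans rZ; rewrite -(mxrank_mul_ker Z Q^T) -addn1 leq_add//.
  by apply: mxrankS; apply: submxMr; exact: addsmxSr.
rewrite -rb; apply: mxrankS.
by rewrite sub_capmx bZ sub_kermx bQ eqxx.
Qed.

(** The witness exceeds the modulus of every element of [s]. *)
Lemma exists_notin (F : numFieldType) (s : seq F) (M : F) : 0 <= M ->
  exists2 x : F, M < x & x \notin s.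
Proof.
move=> M0; exists (M + 1 + \sum_(y <- s) `|y|).
  by rewrite -addrA ltrDl ltr_pwDl// sumr_ge0.
apply/negP => xs; have : M + 1 + \sum_(y <- s) `|y| <= \sum_(y <- s) `|y|.
  rewrite [leRHS](big_rem _ xs)/= -[leLHS]ger0_norm ?lerDl ?sumr_ge0//.
  by rewrite !addr_ge0// sumr_ge0.
rewrite gerDr => M1.
by have := lt_le_trans (ltr_wpDl M0 ltr01) M1; rewrite ltxx.
Qed.

(** If [A] is invertible, [x] is a left eigenvector of [B A^-1] and (p, q) = (1, c). Otherwise [x]
    is in the left kernel of [A] and (p, q) = (0, 1). *)
Lemma pencil_eigenvector (C : numClosedFieldType) n (A B : 'M[C]_n) :
  (0 < n)%N -> exists x a : 'rV[C]_n, x != 0 /\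
  exists p q c : C, [/\ x *m A = p *: a, x *m B = q *: a &
     forall mu, mu != c -> mu * p - q != 0].
Proof.
move=> n0; have [Au|Au] := boolP (A \in unitmx).
  have [c /eigenvalueP [x xB x0]] := eigenvalue_closed (B *m invmx A) n0.
  exists x, (x *m A); split=> //; exists 1, c, c; split.
  - by rewrite scale1r.
  - by rewrite scalemxAl -xB mulmxA mulmxKV.
  - by move=> mu; rewrite mulr1 subr_eq0.
have : kermx A != 0 by rewrite kermx_eq0 row_free_unit.
case/rowV0Pn => x xA x0; exists x, (x *m B); split=> //.
exists 0, 1, 0; split; rewrite ?scale1r ?scale0r//.
  exact/sub_kermxP.
by move=> mu _; rewrite mulr0 sub0r oppr_eq0 oner_neq0.
Qed.

(* Values of [mu] are excluded because the induction step lowers the rank by 2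
   only where [x (mu A - B) <> 0]. *)
Lemma skew_isotropic (C : numClosedFieldType) n w (A B : 'M[C]_n) (s : seq C) :
  A^T = - A -> B^T = - B ->
  (forall mu, mu \notin s -> (\rank (mu *: A - B)%R <= 2 * w)%N) ->
  exists U : 'M[C]_n, [/\ (n - w <= \rank U)%N, U *m A *m U^T = 0 &
     U *m B *m U^T = 0].
Proof.
elim/ltn_ind: n w A B s => n IH w A B s Ask Bsk rAB.
have [n0|n0] := posnP n.
  by exists 0; rewrite !mul0mx n0; split.
have [x [a [x0 [p [q [c [xA xB pq]]]]]]] := pencil_eigenvector A B n0.
have skmu mu : (mu *: A - B)^T = - (mu *: A - B).
  by rewrite linearB linearZ /= Ask Bsk scalerN opprB opprK addrC.
have xmu mu : x *m (mu *: A - B) = (mu * p - q) *: a.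
  by rewrite mulmxBr -scalemxAr xA xB scalerA scalerBl.
pose V := kermx a^T.
(* The rows of [Q] represent a basis of [V] modulo [x]; both forms descend to this quotient, since
   [x A] and [x B] are multiples of [a]. *)
have [k [Q [Qfree QV]]] : exists k (Q : 'M[C]_(k, n)),
    row_free Q /\ (Q :=: V :\: x)%MS.
  by exists (\rank (V :\: x)), (row_base (V :\: x)%MS); split;
    [exact: row_base_free | exact: eq_row_base].
have xx M : M^T = - M -> x *m M *m x^T = 0 by exact: skew_quad0.
have [mu0 _ mu0s] := exists_notin (c :: s) (lexx (0 : C)).
have mu0c : mu0 * p - q != 0.
  by apply: pq; apply: contraNneq mu0s => ->; rewrite mem_head.
(* At [mu0] the factor [mu0 p - q] is nonzero, so skewness of [mu0 A - B] forces [a x^T = 0]. *)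
have xV : (x <= V)%MS.
  rewrite sub_kermx; apply/eqP.
  have := xx _ (skmu mu0); rewrite xmu -scalemxAl => /eqP.
  rewrite scaler_eq0 (negPf mu0c)/= => /eqP ax.
  by rewrite -[LHS]trmxK trmx_mul trmxK ax trmx0.
have rx : \rank x = 1%N by rewrite rank_rV x0.
have rV : \rank V = (n - (a != 0%R))%N by rewrite mxrank_ker mxrank_tr rank_rV.
have Qa : Q *m a^T = 0.
  by apply/sub_kermxP; rewrite QV diffmxSl.
have rQ : k = (n - (a != 0%R)).-1.
  have /eqP <- := Qfree; rewrite QV; have := mxrank_cap_compl V x.
  rewrite rV (_ : \rank (V :&: x)%MS = 1%N) => [<- //|].
  rewrite -[RHS]rx; apply: eqmx_rank.
  by rewrite capmxSr sub_capmx xV submx_refl.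
have kn : (k < n)%N by rewrite rQ; lia.
have skQ M : M^T = - M -> (Q *m M *m Q^T)^T = - (Q *m M *m Q^T).
  by move=> Msk; rewrite !trmx_mul trmxK Msk mulNmx mulmxN mulmxA.
have muQ mu : mu *: (Q *m A *m Q^T) - Q *m B *m Q^T = Q *m (mu *: A - B) *m Q^T.
  by rewrite mulmxBr mulmxBl -scalemxAr -scalemxAl.
have drop mu : a != 0 -> mu \notin c :: s ->
    ((\rank (Q *m (mu *: A - B) *m Q^T)).+2 <= 2 * w)%N.
  rewrite inE negb_or => a0 /andP[muc mus]; apply: leq_trans (rAB _ mus).
  apply: (@rank_skew_perp _ _ _ _ x) => //.
    by rewrite xmu scaler_eq0 (negPf a0) orbF pq.
  by rewrite xmu linearZ /= -scalemxAr Qa scaler0.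
(* If [a = 0], then [x] is in the kernel of both forms and [k = n - 1], with the same [w]. Otherwise
   [k = n - 2], and [w] decreases by one. In both cases adding [x] brings the dimension to
   [n - w]. *)
have [U' [rU' UA UB]] : exists U' : 'M[C]_k,
    [/\ (k - (w - (a != 0%R)) <= \rank U')%N,
        U' *m (Q *m A *m Q^T) *m U'^T = 0 & U' *m (Q *m B *m Q^T) *m U'^T = 0].
  apply: (IH _ kn _ _ _ (c :: s)); [exact: skQ | exact: skQ | move=> mu mus].
  rewrite muQ.
  have [a0|a0] := eqVneq a 0; last by have := drop mu a0 mus; lia.
  move: mus; rewrite inE negb_or subn0 => /andP[_ mus].
  apply: leq_trans (rAB _ mus).
  by apply: leq_trans (mxrankM_maxl _ _) (mxrankM_maxr _ _).
have rUQ : \rank (U' *m Q) = \rank U' by rewrite mxrankMfree.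
have cap0 : (x :&: U' *m Q)%MS = 0.
  apply/eqP; rewrite -submx0 -(capmx_diff V x) capmxC capmxS//.
  by rewrite mulmx_sub// QV.
have aQ : a *m Q^T = 0 by rewrite -[LHS]trmxK trmx_mul trmxK Qa trmx0.
have iso M r : M^T = - M -> x *m M = r *: a ->
    U' *m (Q *m M *m Q^T) *m U'^T = 0 ->
    (x + U' *m Q)%MS *m M *m (x + U' *m Q)%MS^T = 0.
  move=> Msk xM UM; set U := (x + _)%MS.
  have xMQ : x *m M *m (U' *m Q)^T = 0.
    by rewrite xM -scalemxAl trmx_mul mulmxA aQ mul0mx scaler0.
  have QMx : U' *m Q *m M *m x^T = 0.
    rewrite -[LHS]trmxK (trmx_mul _ x^T) trmxK (trmx_mul _ M) Msk.
    by rewrite mulNmx mulmxN mulmxA xMQ oppr0 trmx0.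
  have QMQ : U' *m Q *m M *m (U' *m Q)^T = 0.
    by rewrite trmx_mul !mulmxA in UM *.
  have [L ->] : exists L, U = L *m col_mx x (U' *m Q).
    by apply/submxP; rewrite -addsmxE.
  rewrite trmx_mul tr_col_mx mulmxA -(mulmxA L) mul_col_mx -(mulmxA L).
  by rewrite mul_col_row xx// xMQ QMx QMQ block_mx0 mulmx0 mul0mx.
exists (x + U' *m Q)%MS; split; [|exact: iso xA UA|exact: iso xB UB].
rewrite mxrank_disjoint_sum// rx rUQ; move: rQ rU'.
have [a0|a0] := eqVneq a 0; first by rewrite /=; lia.
(* Here [drop] ensures [1 <= w], so that [w - 1] is not a truncated subtraction. *)
by have := drop _ a0 mu0s; rewrite /=; lia.
Qed.
Lemma exists_row_free (F : fieldType) m k n (U : 'M[F]_(m, n)) :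
  (k <= \rank U)%N -> exists2 V : 'M[F]_(k, n), row_free V & (V <= U)%MS.
Proof.
move=> kU; exists (pid_mx k *m row_base U).
  by rewrite /row_free mxrankMfree ?row_base_free// rank_pid_mx.
by rewrite mulmx_sub// eq_row_base.
Qed.

(** The last [m] rows of [M] are taken in [U] and completed to a basis. [M] does not depend on [A],
    so it suits both coefficients of the pencil. *)
Lemma isotropic_extend (F : fieldType) w m (U : 'M[F]_(w + m)) :
  (m <= \rank U)%N -> exists2 M : 'M[F]_(w + m), M \in unitmx &
  (forall A, U *m A *m U^T = 0 -> drsubmx (M *m A *m M^T) = 0).
Proof.
move=> mU; have [V Vf VU] := exists_row_free mU.
have [|W Wf WV] := @exists_row_free F _ w _ (V^C)%MS.
  by rewrite mxrank_compl (eqP Vf) addnK.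
exists (col_mx W V).
  rewrite -row_full_unit /row_full -addsmxE.
  rewrite mxrank_disjoint_sum ?(eqP Vf) ?(eqP Wf)//.
  by apply/eqP; rewrite -submx0 -(capmx_compl V) capmxC capmxS.
move=> A UA; have [L VE] := submxP VU.
rewrite tr_col_mx mul_col_mx mul_col_row block_mxKdr VE trmx_mul.
by rewrite -!mulmxA (mulmxA U) (mulmxA (U *m A)) UA mul0mx mulmx0.
Qed.

(** * The pencil [I 0] - [0 I] *)

(* The sum [S] telescopes along (i, j), (i - d, j + d), ..., which gives a
   solution without the symmetry; averaging it with its transpose then only
   averages [X] with [- X^T = X]. *)
Lemma antidiagonal_solve (F : numFieldType) d (X : nat -> nat -> F) :
  (0 < d)%N -> (forall i j, X j i = - X i j) ->
  exists y : nat -> nat -> F, (forall i j, y i j = y j i) /\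
    forall i j, y (i + d)%N j - y i (j + d)%N = X i j.
Proof.
move=> d0 Xsk.
pose S i j := \sum_(k < i %/ d) X (i - k.+1 * d)%N (j + k * d)%N.
have SE i j : S (i + d)%N j = X i j + S i (j + d)%N.
  rewrite /S divnDr// divnn d0 addn1 big_ord_recl/= mul1n addnK addn0.
  congr (_ + _); apply: eq_bigr => k _; rewrite /bump/=; congr X; lia.
exists (fun i j => (S i j + S j i) / 2%:R); split=> [i j|i j].
  by rewrite addrC.
have two : (2%:R : F) != 0 by rewrite pnatr_eq0.
apply: (mulIf two); rewrite mulrBl !divfK// SE (SE j i) (Xsk i j); ring.
Qed.

(** [Gtrunc] and [Ftrunc] are the matrices [I_w 0] and [0 I_w]. For [d = 1] they are G_w and F_w; in
    general they interleave [d] such blocks. *)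
Definition Gtrunc (F : nzRingType) w d : 'M[F]_(w, w + d) :=
  \matrix_(i, j) (j == i :> nat)%:R.
Definition Ftrunc (F : nzRingType) w d : 'M[F]_(w, w + d) :=
  \matrix_(i, j) (j == (i + d)%N :> nat)%:R.

(** Entries are given by functions on [nat], so that the products here and below become shifts of
    indices. *)
Lemma Gtrunc_mul (F : nzRingType) w d p (Z : nat -> nat -> F) :
  Gtrunc F w d *m (\matrix_(i < w + d, j < p) Z i j) = \matrix_(i, j) Z i j.
Proof.
apply/matrixP => i j; rewrite !mxE (bigD1 (lshift d i))//= !mxE eqxx mul1r.
rewrite big1 ?addr0// => k ki; rewrite !mxE (_ : (_ == _) = false) ?mul0r//.
by apply: contraNF ki => /eqP ki; apply/eqP/val_inj.
Qed.

Lemma Ftrunc_mul (F : nzRingType) w d p (Z : nat -> nat -> F) :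
  Ftrunc F w d *m (\matrix_(i < w + d, j < p) Z i j) =
  \matrix_(i, j) Z (i + d)%N j.
Proof.
apply/matrixP => i j; rewrite !mxE.
have ilt : (i + d < w + d)%N by rewrite ltn_add2r.
rewrite (bigD1 (Ordinal ilt))//= !mxE eqxx mul1r.
rewrite big1 ?addr0// => k ki; rewrite !mxE (_ : (_ == _) = false) ?mul0r//.
by apply: contraNF ki => /eqP ki; apply/eqP/val_inj.
Qed.

Lemma mul_Gtrunc (F : nzRingType) w d p (S : nat -> nat -> F) :
  (\matrix_(i < p, j < w) S i j) *m Gtrunc F w d =
  \matrix_(i, j) (if (j < w)%N then S i j else 0).
Proof.
apply/matrixP => i j; rewrite !mxE; case: ifP => jw; last first.
  rewrite big1// => k _; rewrite !mxE (_ : (_ == _) = false) ?mulr0//.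
  by apply: contraFF jw => /eqP ->.
rewrite (bigD1 (Ordinal jw))//= !mxE eqxx mulr1.
rewrite big1 ?addr0// => k ki; rewrite !mxE (_ : (_ == _) = false) ?mulr0//.
by apply: contraNF ki => /eqP ki; apply/eqP/val_inj.
Qed.

Lemma mul_Ftrunc (F : nzRingType) w d p (S : nat -> nat -> F) :
  (\matrix_(i < p, j < w) S i j) *m Ftrunc F w d =
  \matrix_(i, j) (if (d <= j)%N then S i (j - d)%N else 0).
Proof.
apply/matrixP => i j; rewrite !mxE; case: ifP => jw; last first.
  rewrite big1// => k _; rewrite !mxE (_ : (_ == _) = false) ?mulr0//.
  by apply: contraFF jw => /eqP ->; rewrite leq_addl.
have ilt : (j - d < w)%N by have := ltn_ord j; lia.
rewrite (bigD1 (Ordinal ilt))//= !mxE subnK// eqxx mulr1.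
rewrite big1 ?addr0// => k ki; rewrite !mxE (_ : (_ == _) = false) ?mulr0//.
apply: contraNF ki => /eqP ki; apply/eqP/val_inj => /=; lia.
Qed.

(* Extension of [M] by 0 outside its index range. *)
Definition mx_nat (V : nmodType) m n (M : 'M[V]_(m, n)) (i j : nat) : V :=
  if insub i is Some i' then if insub j is Some j' then M i' j' else 0 else 0.

Lemma mx_natE (V : nmodType) m n (M : 'M[V]_(m, n)) (i : 'I_m) (j : 'I_n) :
  mx_nat M i j = M i j.
Proof. by rewrite /mx_nat !valK. Qed.

(** Extend [X1] by 0 and put [Z = X1 / 2 + y]. Any symmetric [y] satisfies the first equation; the
    second one then prescribes [y (i + d) j - y i (j + d)], with skew right-hand side [X']. *)
Lemma skew_corner_solve (F : numFieldType) w d (X1 X2 : 'M[F]_w) :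
  (0 < d)%N -> X1^T = - X1 -> X2^T = - X2 ->
  exists Z : 'M[F]_(w + d, w),
    Gtrunc F w d *m Z - (Gtrunc F w d *m Z)^T = X1 /\
    Ftrunc F w d *m Z - (Ftrunc F w d *m Z)^T = X2.
Proof.
move=> d0 X1sk X2sk.
pose e (X : 'M[F]_w) := mx_nat X.
have esk X : X^T = - X -> forall i j, e X j i = - e X i j.
  move=> Xsk i j; rewrite /e /mx_nat.
  case: insub => [i'|]; case: insub => [j'|]//; rewrite ?oppr0//.
  by move/matrixP/(_ j' i'): Xsk; rewrite !mxE => ->.
have eE X (i j : 'I_w) : e X i j = X i j by exact: mx_natE.
pose X' i j := e X2 i j - (e X1 (i + d)%N j - e X1 (j + d)%N i) / 2%:R.
have [|y [ysym yE]] := @antidiagonal_solve F d X' d0.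
  move=> i j; rewrite /X' (esk _ X2sk i j) -[e X1 (j + d)%N i - _]opprB mulNr.
  by rewrite opprB opprK addrC.
pose z i j := e X1 i j / 2%:R + y i j.
have two : (2%:R : F) != 0 by rewrite pnatr_eq0.
exists (\matrix_(i, j) z i j); rewrite Gtrunc_mul Ftrunc_mul; split;
  apply/matrixP => i j; rewrite !mxE -eE.
  by rewrite /z (ysym j i) (esk _ X1sk i j); field.
rewrite /z (ysym (j + d)%N i).
rewrite (_ : y (i + d)%N j = X' i j + y i (j + d)%N); last by rewrite -yE subrK.
by rewrite /X'; field.
Qed.

(* The equations prescribe [s] at the start of a diagonal chain (i, j),
   (i + d, j + d), ... when j < d <= i, and at its end when it leaves through
   the right side, which forces i < j. Hence chains with j <= i are summed from
   their start and the others from their end. *)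
Lemma shift_solve (V : zmodType) w d (e : nat -> nat -> V) : (0 < d)%N ->
  (forall i j, (w <= i + d)%N || (w + d <= j)%N -> e i j = 0) ->
  exists s : nat -> nat -> V, forall i j, (i + d < w)%N -> (j < w + d)%N ->
    (if (j < w)%N then s (i + d)%N j else 0)
    - (if (d <= j)%N then s i (j - d)%N else 0) = e i j.
Proof.
move=> d0 e0.
(* The condition [k * d <= j] stops the sum at the start of the chain; beyond it the truncated
   [j - k * d] would stay at 0. *)
pose a i j :=
  \sum_(k < i %/ d | (k * d <= j)%N) e (i - k.+1 * d)%N (j - k * d)%N.
pose b i j := - \sum_(k < w) e (i + k * d)%N (j + k.+1 * d)%N.
have aD i j : a (i + d)%N (j + d)%N = e i (j + d)%N + a i j.
  rewrite /a divnDr// divnn d0 addn1 big_mkcond big_ord_recl/=.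
  rewrite mul0n mul1n addnK subn0; congr (_ + _).
  rewrite [RHS]big_mkcond; apply: eq_bigr => k _; rewrite /bump/=.
  rewrite (_ : (_ <= _)%N = (k * d <= j)%N); last by lia.
  by case: ifP => // _; congr e; lia.
have a0 i j : (j < d)%N -> a (i + d)%N j = e i j.
  move=> jd; rewrite /a divnDr// divnn d0 addn1 big_mkcond big_ord_recl/=.
  rewrite mul0n mul1n addnK subn0 big1 ?addr0// => k _; rewrite /bump/=.
  by rewrite leqNgt (leq_trans jd)//; lia.
have bD i j : b (i + d)%N (j + d)%N = e i (j + d)%N + b i j.
  pose f k := e (i + k * d)%N (j + k.+1 * d)%N.
  have sf : \sum_(k < w) f k = f 0%N + \sum_(k < w) f k.+1.
    (* The extra term [f w] vanishes, because its row index is at least [w]. *)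
    rewrite -(big_ord_recl w (fun k => f k)) big_ord_recr/= [f w]e0 ?addr0//.
    by apply/orP; left; nia.
  rewrite /b [X in _ = _ - X]sf opprD addrA.
  rewrite (_ : f 0%N = e i (j + d)%N) ?subrr ?add0r; last first.
    by rewrite /f mul0n addn0 mul1n.
  by congr (- _); apply: eq_bigr => k _; rewrite /f; congr e; lia.
have b0 i j : (i + d < w)%N -> (w <= j)%N -> b i (j - d)%N = - e i j.
  move=> iw wj; have [w' wE] : exists w', w = w'.+1 by exists w.-1; lia.
  rewrite /b; congr (- _); rewrite [in LHS]wE big_ord_recl/= big1 ?addr0.
    by congr e; lia.
  by move=> k _; rewrite e0// /bump/=; apply/orP; right; nia.
exists (fun i j => if (j <= i)%N then a i j else b i j) => i j iw jw.
have [dj|jd] := leqP d j; last first.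
  have jw' : (j < w)%N := ltn_trans (leq_trans jd (leq_addl i d)) iw.
  by rewrite subr0 jw' (ltnW (leq_trans jd (leq_addl i d))) a0.
have [jw'|wj] := ltnP j w; last first.
  have ij : (i < j - d)%N by rewrite ltn_subRL addnC (leq_trans iw).
  by rewrite sub0r leqNgt ij b0// opprK.
have := aD i (j - d)%N; have := bD i (j - d)%N; rewrite subnK// => -> ->.
rewrite leq_subLR addnC.
by case: ifP => _; rewrite addrK.
Qed.

(** The first equation determines rows [i < w] of [T] from [S], and the second one rows [i + d]. On
    the overlap [i + d < w] the two values must agree, which is the shift equation for [S] with
    right-hand side [e]. *)
Lemma trunc_equiv_surj (F : nzRingType) w d (E1 E2 : 'M[F]_(w, w + d)) :
  (0 < d)%N -> exists (S : 'M[F]_w) (T : 'M[F]_(w + d)),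
    S *m Gtrunc F w d - Gtrunc F w d *m T = E1 /\
    S *m Ftrunc F w d - Ftrunc F w d *m T = E2.
Proof.
move=> d0.
pose e i j := if (i + d < w)%N && (j < w + d)%N
  then mx_nat E1 (i + d)%N j - mx_nat E2 i j else 0.
have [|s sE] := @shift_solve F w d e d0.
  by move=> i j ij; rewrite /e; case: ifP => //; lia.
pose t i j := if (i < w)%N then (if (j < w)%N then s i j else 0) - mx_nat E1 i j
  else (if (d <= j)%N then s (i - d)%N (j - d)%N else 0)
    - mx_nat E2 (i - d)%N j.
exists (\matrix_(i, j) s i j), (\matrix_(i, j) t i j).
rewrite mul_Gtrunc mul_Ftrunc Gtrunc_mul Ftrunc_mul.
split; apply/matrixP => i j; rewrite !mxE -mx_natE /t.
  by rewrite ltn_ord opprB addrC subrK.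
have [iw|wi] := ltnP (i + d)%N w; last by rewrite addnK opprB addrC subrK.
have := sE i j iw (ltn_ord j); rewrite /e iw ltn_ord/=.
by move=> /(canRL (subrK _)) ->; rewrite opprB opprD
  (addrA (mx_nat E1 _ _)) subKr addrC subrK.
Qed.
(** * Generic strict equivalence and congruence *)

(* By Cramer: if [L] is a right inverse of the map [A + B] at t = 1, then [v] is
   det(L P) times the projection of [v0] on the kernel of [P] along [L]. *)
Lemma polynomial_kernel_vector (F : fieldType) p q (A B : 'M[F]_(p, q))
    (v0 : 'rV[F]_p) : row_full (A + B)%R -> v0 *m (A + B) = 0 ->
  exists2 v : 'rV[{poly F}]_p, map_mx (horner_eval 1) v = v0 &
    forall t, map_mx (horner_eval t) v *m (A + t *: B) = 0.
Proof.
move=> /row_fullP[L LAB] v0AB.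
pose P : 'M[{poly F}]_(p, q) := map_mx polyC A + 'X *: map_mx polyC B.
have evC t m n (M : 'M[F]_(m, n)) : map_mx (horner_eval t) (map_mx polyC M) = M.
  by apply/matrixP => i j; rewrite !mxE /= /horner_eval hornerC.
have evP t : map_mx (horner_eval t) P = A + t *: B.
  by rewrite map_mxD map_mxZ !evC /= /horner_eval hornerX.
pose G := map_mx polyC L *m P.
pose v := \det G *: map_mx polyC v0
  - map_mx polyC v0 *m P *m \adj G *m map_mx polyC L.
exists v.
  rewrite map_mxB map_mxZ !map_mxM !evC evP scale1r v0AB !mul0mx subr0.
  by rewrite -det_map_mx map_mxM evC evP scale1r LAB det1 scale1r.
move=> t; rewrite -evP -map_mxM mulmxBl -scalemxAl -!mulmxA -/G mul_adj_mx.
by rewrite mulmxA mul_mx_scalar subrr map_mx0.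
Qed.

(** The unknowns (S, T) satisfy a homogeneous linear system that is affine in [t]. At [t = 1] it has
    full rank by hypothesis and the solution (1, 1), which extends to a polynomial solution. Its
    product of determinants [q] has value 1 at 1, hence is nonzero. *)
Lemma equiv_generic_on_line (F : fieldType) w m (K1 K2 L1 L2 : 'M[F]_(w, m)) :
  (forall E1 E2, exists S T,
     S *m L1 - L1 *m T = E1 /\ S *m L2 - L2 *m T = E2) ->
  exists2 q : {poly F}, q != 0 & forall t, q.[t] != 0 ->
    exists S T, [/\ S \in unitmx, T \in unitmx,
      S *m L1 = (K1 + t *: (L1 - K1)) *m T &
      S *m L2 = (K2 + t *: (L2 - K2)) *m T].
Proof.
move=> surj.
pose A : 'M[F]_(w * w + m * m, w * m + w * m) := block_mx
  (lin_mulmxr L1) (lin_mulmxr L2) (- lin_mulmx K1) (- lin_mulmx K2).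
pose B : 'M[F]_(w * w + m * m, w * m + w * m) := block_mx
  0 0 (- lin_mulmx (L1 - K1)) (- lin_mulmx (L2 - K2)).
have ABE t (S : 'M[F]_w) (T : 'M[F]_m) :
    row_mx (mxvec S) (mxvec T) *m (A + t *: B) =
    row_mx (mxvec (S *m L1 - (K1 + t *: (L1 - K1)) *m T))
           (mxvec (S *m L2 - (K2 + t *: (L2 - K2)) *m T)).
  rewrite scale_block_mx add_block_mx mul_row_block !scaler0 !addr0.
  rewrite !mulmxDr !mul_vec_lin -!scalemxAr !mulmxN !mul_vec_lin /=.
  by congr row_mx; rewrite [in RHS]linearB/= [in RHS]mulmxDl -scalemxAl
    [in RHS]linearD/= [in RHS]linearZ/= scalerN opprD.
pose v0 : 'rV[F]_(w * w + m * m) := 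
  row_mx (mxvec (1%:M : 'M[F]_w)) (mxvec (1%:M : 'M[F]_m)).
have [||v v1 vt] := @polynomial_kernel_vector F _ _ A B v0.
- have fullAB (u : 'rV[F]_(w * m + w * m)) : (u <= (A + B)%R)%MS.
    have [S [T [E1 E2]]] := surj (vec_mx (lsubmx u)) (vec_mx (rsubmx u)).
    apply/submxP; exists (row_mx (mxvec S) (mxvec T)).
    rewrite -[B]scale1r ABE !scale1r ![K1 + _]addrC ![K2 + _]addrC !subrK E1 E2.
    by rewrite !vec_mxK hsubmxK.
  by rewrite -sub1mx; apply/row_subP.
- rewrite -[B]scale1r ABE !scale1r ![K1 + _]addrC ![K2 + _]addrC !subrK.
  by rewrite !mul1mx !mulmx1 !subrr linear0 row_mx0.
pose S := vec_mx (lsubmx v); pose T := vec_mx (rsubmx v).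
have evS t : (\det S * \det T).[t] =
    \det (map_mx (horner_eval t) S) * \det (map_mx (horner_eval t) T).
  by rewrite hornerM !det_map_mx.
have vE t : map_mx (horner_eval t) v = row_mx
    (mxvec (map_mx (horner_eval t) S)) (mxvec (map_mx (horner_eval t) T)).
  by rewrite -!map_mxvec !vec_mxK -map_row_mx hsubmxK.
exists (\det S * \det T).
  apply: contraTneq (oner_neq0 F) => q0.
  have := evS 1; rewrite q0 horner0; move: v1; rewrite vE /v0 => /eq_row_mx[].
  move=> /(can_inj mxvecK) -> /(can_inj mxvecK) ->.
  by rewrite !det1 mulr1 => <-; rewrite eqxx.
move=> t; rewrite evS mulf_eq0 negb_or => /andP[S0 T0].
exists (map_mx (horner_eval t) S), (map_mx (horner_eval t) T).
rewrite !unitmxE !unitfE; split=> //.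
  have := vt t; rewrite vE ABE -[RHS]row_mx0 => /eq_row_mx[+ _].
  by move/eqP; rewrite mxvec_eq0 subr_eq0 => /eqP.
have := vt t; rewrite vE ABE -[RHS]row_mx0 => /eq_row_mx[_].
by move/eqP; rewrite mxvec_eq0 subr_eq0 => /eqP.
Qed.

Lemma skew_congr (R : comNzRingType) n m (M : 'M[R]_n) (S : 'M[R]_(n, m)) :
  M^T = - M -> (S^T *m M *m S)^T = - (S^T *m M *m S).
Proof. by move=> Msk; rewrite !trmx_mul trmxK Msk mulNmx mulmxN mulmxA. Qed.

Definition corner_mx (R : nzRingType) m n (K : 'M[R]_(m, n)) : 'M[R]_(m + n) :=
  block_mx 0 K (- K^T) 0.

Lemma skew_corner_mx (R : nzRingType) m n (K : 'M[R]_(m, n)) :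
  (corner_mx K)^T = - corner_mx K.
Proof.
by rewrite tr_block_mx opp_block_mx !trmx0 !oppr0 opprK linearN /= trmxK.
Qed.

(** [S] and [T] turn [G] into [K], while [Z] produces the upper left block. As [P] depends only on
    [S], [T] and [Z], one congruence serves both coefficients. *)
Lemma corner_congr (F : fieldType) m n (X S : 'M[F]_m) (K G : 'M[F]_(m, n))
    (T : 'M[F]_n) (Z : 'M[F]_(n, m)) :
  S \in unitmx -> T \in unitmx -> S *m G = K *m T ->
  G *m Z - (G *m Z)^T = invmx S *m X *m (invmx S)^T ->
  let P := block_mx S^T 0 (Z *m S^T) (invmx T) in
  block_mx X K (- K^T) 0 = P^T *m corner_mx G *m P.
Proof.
move=> Su Tu SG GZ /=.
have KE : S *m G *m invmx T = K by rewrite SG mulmxK.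
have -> : X = S *m (G *m Z - (G *m Z)^T) *m S^T.
  by rewrite GZ !mulmxA mulmxV// mul1mx -mulmxA -trmx_mul mulmxV// trmx1 mulmx1.
rewrite tr_block_mx !mulmx_block trmx0 !mul0mx !mulmx0 !add0r !addr0 trmxK.
congr block_mx.
- by rewrite mulmxBr mulmxBl !trmx_mul trmxK mulmxN !mulNmx !mulmxA addrC.
- by rewrite KE.
- by rewrite mul0mx addr0 -[in LHS]KE trmx_mul mulmxN mulNmx trmx_mul mulmxA.
- by rewrite mul0mx.
Qed.

Lemma skew_rank_generic_line (C : numClosedFieldType) w d
    (A B : 'M[C]_(w + (w + d))) :
  (0 < d)%N -> A^T = - A -> B^T = - B ->
  (forall mu, (\rank (mu *: A - B)%R <= 2 * w)%N) ->
  exists E1 E2 : 'M[C]_(w + (w + d)), [/\ E1^T = - E1, E2^T = - E2 &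
  exists2 q : {poly C}, q != 0 & forall t, q.[t] != 0 ->
    exists2 S, S \in unitmx &
      A + t *: E1 = S^T *m corner_mx (Gtrunc C w d) *m S /\
      B + t *: E2 = S^T *m corner_mx (Ftrunc C w d) *m S].
Proof.
move=> d0 Ask Bsk rAB.
have [|U [rU UA UB]] := @skew_isotropic _ _ w _ _ [::] Ask Bsk.
  by move=> mu _; exact: rAB.
have [|M Mu Miso] := @isotropic_extend _ w (w + d) U.
  by rewrite -[X in (X <= _)%N](addKn w).
pose K (D : 'M[C]_(w + (w + d))) := ursubmx (M *m D *m M^T).
pose X (D : 'M[C]_(w + (w + d))) := ulsubmx (M *m D *m M^T).
have skM D : D^T = - D -> (M *m D *m M^T)^T = - (M *m D *m M^T).
  by move=> /(skew_congr M^T); rewrite trmxK.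
have blockE D : D^T = - D -> U *m D *m U^T = 0 ->
    M *m D *m M^T = block_mx (X D) (K D) (- (K D)^T) 0.
  move=> Dsk UD; rewrite -[LHS]submxK Miso//; congr block_mx.
  by rewrite /K trmx_ursub skM//; apply/matrixP => i j; rewrite !mxE opprK.
have Xsk D : D^T = - D -> (X D)^T = - X D.
  move=> Dsk; rewrite /X trmx_ulsub skM//.
  by apply/matrixP => i j; rewrite !mxE.
have [q q0 qP] := equiv_generic_on_line (K A) (K B)
  (fun E1 E2 => trunc_equiv_surj E1 E2 d0).
(* In the basis given by [M] the line moves only the off-diagonal blocks, which reach [Gtrunc] and
   [Ftrunc] at [t = 1]; the upper left block stays fixed. *)
pose E1 := corner_mx (Gtrunc C w d - K A).
pose E2 := corner_mx (Ftrunc C w d - K B).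
pose N := invmx M.
have Nu : N^T \in unitmx by rewrite unitmx_tr unitmx_inv.
exists (N *m E1 *m N^T), (N *m E2 *m N^T); split.
- have := skew_congr N^T (skew_corner_mx (Gtrunc C w d - K A)).
  by rewrite trmxK.
- have := skew_congr N^T (skew_corner_mx (Ftrunc C w d - K B)).
  by rewrite trmxK.
exists q => // t /qP[S [T [Su Tu SG SF]]].
have NM D : D = N *m (M *m D *m M^T) *m N^T.
  rewrite -!mulmxA -trmx_mul mulVmx// trmx1 mulmx1 mulKmx//.
have Xsk' D : D^T = - D ->
    (invmx S *m X D *m (invmx S)^T)^T = - (invmx S *m X D *m (invmx S)^T).
  by move=> /Xsk/(skew_congr (invmx S)^T); rewrite trmxK.
have [Z [ZG ZF]] := skew_corner_solve d0 (Xsk' A Ask) (Xsk' B Bsk).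
pose P := block_mx S^T 0 (Z *m S^T) (invmx T).
have Pu : P \in unitmx.
  by rewrite unitmxE det_lblock unitrM -!unitmxE unitmx_tr unitmx_inv Su.
exists (P *m N^T); first by rewrite unitmx_mul Pu.
have final D G : D^T = - D -> U *m D *m U^T = 0 ->
    S *m G = (K D + t *: (G - K D)) *m T ->
    G *m Z - (G *m Z)^T = invmx S *m X D *m (invmx S)^T ->
    D + t *: (N *m corner_mx (G - K D) *m N^T) =
    (P *m N^T)^T *m corner_mx G *m (P *m N^T).
  move=> Dsk UD SGD ZGD; have := corner_congr Su Tu SGD ZGD; rewrite -/P => PE.
  have -> : (P *m N^T)^T *m corner_mx G *m (P *m N^T) =
      N *m (P^T *m corner_mx G *m P) *m N^T.
    by rewrite trmx_mul trmxK !mulmxA.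
  rewrite -PE {1}(NM D) blockE// scalemxAl scalemxAr -mulmxDl -mulmxDr.
  congr (_ *m _ *m _).
  rewrite scale_block_mx add_block_mx !scaler0 !addr0; congr block_mx.
  by rewrite scalerN -opprD !linearD /= !linearZ.
split; exact: final.
Qed.

(** * The canonical form up to permutation *)

(** Entries are written through a relation on natural numbers, so that comparing the two forms of
    [W] reduces to comparing relations on indices. *)
Lemma corner_mxE (F : nzRingType) m n (K : 'M[F]_(m, n))
    (h : nat -> nat -> bool) :
  (forall i j, K i j = (h i j)%:R) ->
  let c i j := [&& i < m, m <= j & h i (j - m)]%N in
  forall i j : 'I_(m + n), corner_mx K i j = (c i j)%:R - (c j i)%:R.
Proof.
move=> Kh c i j; rewrite /c -{1}(splitK i) -{1}(splitK j).
case: splitP => i' ->; case: splitP => j' -> /=.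
- by rewrite block_mxEul mxE !(leqNgt m) !ltn_ord /= subrr.
- by rewrite block_mxEur Kh leq_addr addKn subr0.
- by rewrite block_mxEdl !mxE Kh leq_addr addKn sub0r.
- by rewrite block_mxEdr mxE subrr.
Qed.

Lemma mxdiag_entry (V : nmodType) p (p_ : 'I_p -> nat)
    (B_ : forall i, 'M[V]_(p_ i)) (g : nat -> nat -> nat -> V) :
  (forall i a b, B_ i a b = g i a b) ->
  forall s t, (\mxdiag_i B_ i) s t = if tagnat.sig1 s == tagnat.sig1 t
    then g (tagnat.sig1 s) (tagnat.sig2 s) (tagnat.sig2 t) else 0.
Proof.
move=> Bg s t; rewrite !mxE /tagnat.sig1 /tagnat.sig2.
case: (tagnat.sig s) (tagnat.sig t) => [/= i a] [/= j b].
case: eqP => [<-|ni] in b *; last by rewrite mxE.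
by rewrite conform_mx_id Bg.
Qed.

Lemma congr_of_reindex (F : fieldType) n (f : 'I_n -> 'I_n) : injective f ->
  exists2 S : 'M[F]_n, S \in unitmx &
  forall A B : 'M[F]_n,
    (forall i j, A i j = B (f i) (f j)) -> A = S^T *m B *m S.
Proof.
move=> finj; pose s := perm finj.
exists (perm_mx s)^T; first by rewrite unitmx_tr unitmx_perm.
move=> A B AB; rewrite trmxK tr_perm_mx -row_permE -col_permE.
by apply/matrixP => i j; rewrite !mxE AB !permE.
Qed.

(** [Windex n w r] counts the integers below [w] that are congruent to [r] modulo [n - 2w]. *)
Lemma Windex_lt n w r t : (r < n - 2 * w)%N ->
  (t < Windex n w r)%N = (r + t * (n - 2 * w) < w)%N.
Proof.
rewrite /Windex; set d := (n - 2 * w)%N => rd.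
rewrite [X in (_ = (_ < X)%N)](divn_eq w d).
have := ltn_pmod w (leq_ltn_trans (leq0n r) rd).
move: (w %/ d)%N (w %% d)%N => a s sd.
have [tlt|tge|->] := ltngtP t a.
- have : (t.+1 * d <= a * d)%N by rewrite leq_mul2r tlt orbT.
  rewrite mulSn => h; case: ifP => rs; lia.
- have : (a.+1 * d <= t * d)%N by rewrite leq_mul2r tge orbT.
  rewrite mulSn => h; case: ifP => rs; lia.
- by case: ifP => rs; lia.
Qed.

(* The residue class [r] modulo [d = n - 2w] carries the block of index [r]:
   its row [t] becomes row [r + t d] and its column [u] becomes column
   [r + u d] of [Gtrunc] and [Ftrunc]. *)
Definition Wplace n w r t : nat :=
  let k := Windex n w r in
  if (t < k)%N then (r + t * (n - 2 * w))%N
  else (w + (r + (t - k) * (n - 2 * w)))%N.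

Lemma addMn_inj d r r' t t' : (r < d)%N -> (r' < d)%N ->
  ((r + t * d == r' + t' * d) = (r == r') && (t == t'))%N.
Proof.
move=> rd rd'; apply/eqP/andP => [e|[/eqP-> /eqP->]//].
have := congr1 (modn^~ d) e.
rewrite ![(_ + _ * d)%N]addnC !modnMDl !modn_small// => rr.
move: e; rewrite rr => /addnI/eqP; rewrite eqn_mul2r eqxx.
case/orP => // /eqP d0.
by rewrite d0 in rd.
Qed.

Lemma Wplace_lt n w r t : (r < n - 2 * w)%N ->
  (Wplace n w r t < w)%N = (t < Windex n w r)%N.
Proof.
move=> rd; rewrite /Wplace; case: ifP => tk; first by rewrite -Windex_lt.
by apply/negbTE; rewrite -leqNgt leq_addr.
Qed.

Lemma Wplace_bound n w r t : (2 * w <= n)%N -> (r < n - 2 * w)%N ->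
  (t < Windex n w r + (Windex n w r).+1)%N -> (Wplace n w r t < n)%N.
Proof.
move=> wn rd tk; have := Wplace_lt t rd.
case: (ltnP t) => [_ /idP|kt _]; first by lia.
rewrite /Wplace [(t < _)%N]ltnNge kt/=.
have : (t - Windex n w r <= Windex n w r)%N by lia.
case: (posnP (t - Windex n w r)) => [->|]; first by lia.
move: (t - _)%N => u u0 uk.
have : (u.-1 < Windex n w r)%N by lia.
by rewrite Windex_lt//; case: u u0 {uk} => // u _; rewrite /= mulSn; lia.
Qed.

Lemma Wplace_inj n w r t r' t' : (r < n - 2 * w)%N -> (r' < n - 2 * w)%N ->
  Wplace n w r t = Wplace n w r' t' -> r = r' /\ t = t'.
Proof.
move=> rd rd' e.
have tt : (t < Windex n w r)%N = (t' < Windex n w r')%N.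
  by rewrite -!Wplace_lt// e.
move: e; rewrite /Wplace -tt; case: ifP tt => tk tt.
  by move/eqP; rewrite addMn_inj// => /andP[/eqP-> /eqP->].
move/addnI/eqP; rewrite addMn_inj// => /andP[/eqP rr /eqP tt']; subst r'.
by split=> //; move/negbT: tk; move/esym/negbT: tt; rewrite -!leqNgt; lia.
Qed.

(** For [c = 0] and [c = 1] the left side locates the ones of [Gtrunc] and [Ftrunc], and the right
    side those of G_k and F_k in a single block. They correspond because [r + t d] determines [r]
    and [t]. *)
Lemma Wplace_shift n w r t r' t' c : (r < n - 2 * w)%N -> (r' < n - 2 * w)%N ->
  let d := (n - 2 * w)%N in
  [&& Wplace n w r t < w, w <= Wplace n w r' t' &
    Wplace n w r' t' - w == Wplace n w r t + c * d]%N =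
  (r == r') && [&& t < Windex n w r, Windex n w r <= t' &
    t' - Windex n w r == t + c]%N.
Proof.
move=> rd rd' d; rewrite Wplace_lt// (leqNgt w) Wplace_lt// -leqNgt.
rewrite /Wplace; have [tk|] := ltnP t; last by rewrite andbF.
rewrite /=; have [t'k|kt'] := ltnP t' (Windex n w r').
  by have [rr|] := eqVneq r r' => //=; rewrite rr leqNgt t'k.
rewrite /= addKn -addnA -mulnDl addMn_inj// eq_sym.
by have [->|//] := eqVneq r r'; rewrite kt'.
Qed.

Lemma Wpencil_congr (R : realType) n w (hw : (2 <= 2 * w <= n - 1)%N)
    (e : (w + (w + (n - 2 * w)) = n)%N) :
  exists2 S : 'M[R[i]]_n, S \in unitmx & pencil_val (Wpencil R hw) =
    (S^T *m castmx (e, e) (corner_mx (Gtrunc R[i] w (n - 2 * w))) *m S,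
     S^T *m castmx (e, e) (corner_mx (Ftrunc R[i] w (n - 2 * w))) *m S).
Proof.
have wn : (2 * w <= n)%N by rewrite -[leqRHS]e; lia.
pose c (x : 'I_n) := cast_ord (esym (Wsize hw)) x.
pose f1 x := tagnat.sig1 (c x); pose f2 x : nat := tagnat.sig2 (c x).
have flt x : (Wplace n w (f1 x) (f2 x) < n)%N.
  by apply: Wplace_bound => //; exact: ltn_ord.
pose f x := Ordinal (flt x).
have finj : injective f.
  move=> x y /(congr1 val)/= /Wplace_inj[]// /val_inj e1 e2.
  apply: (@cast_ord_inj _ _ (esym (Wsize hw))); apply: val_inj; apply/eqP.
  rewrite -(tagnat.sig2K (cast_ord _ x)) -(tagnat.sig2K (cast_ord _ y)).
  by rewrite tagnat.eq_Rank; apply/andP; split; apply/eqP.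
have [S Su SP] := congr_of_reindex R[i] finj.
exists S => //.
(* The shift [c0] is 0 for the G matrices and 1 for the F matrices; the same [S] works for both. *)
have key c0 (K : forall k, 'M[R[i]]_(k, k.+1))
      (L : 'M[R[i]]_(w, w + (n - 2 * w))) :
    (forall k i j, K k i j = (j == i + c0 :> nat)%N%:R) ->
    (forall i j, L i j = (j == i + c0 * (n - 2 * w) :> nat)%N%:R) ->
    castmx (Wsize hw, Wsize hw)
      (\mxdiag_(r < n - 2 * w) corner_mx (K (Windex n w r))) =
    S^T *m castmx (e, e) (corner_mx L) *m S.
  move=> KE LE; apply: SP => x y; rewrite !castmxE/=.
  pose g r a b : R[i] := let k := Windex n w r in
    [&& a < k, k <= b & b - k == a + c0]%N%:R
    - [&& b < k, k <= a & a - k == b + c0]%N%:R.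
  rewrite (@mxdiag_entry _ _ _ _ g); last first.
    move=> r a b.
    by rewrite (@corner_mxE _ _ _ _ (fun a b => b == a + c0)%N (KE _)).
  rewrite (@corner_mxE _ _ _ _ (fun a b => b == a + c0 * (n - 2 * w))%N LE)/=.
  rewrite !Wplace_shift// -/(c x) -/(c y) -/(f1 x) -/(f1 y).
  rewrite -/(f2 x) -/(f2 y); move: (f2 x) (f2 y) => a b.
  rewrite [f1 y == f1 x :> nat]eq_sym -!val_eqE /=.
  by case: eqP => //= [->|_]; rewrite ?subrr.
have keyG := key 0%N (@Gmx R) (Gtrunc _ w (n - 2 * w)).
have keyF := key 1%N (@Fmx R) (Ftrunc _ w (n - 2 * w)).
rewrite -keyG -?keyF.
- by [].
- by move=> k i j; rewrite mxE addn1.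
- by move=> i j; rewrite mxE mul1n.
- by move=> k i j; rewrite mxE addn0.
- by move=> i j; rewrite mxE mul0n addn0.
Qed.

(** * Rank and minors *)

Lemma incr_enum_val n (A : {set 'I_n}) : incr_ord (enum_val : 'I_#|A| -> 'I_n).
Proof.
apply/forallP => i; apply/forallP => j; apply/implyP => ij.
have sortedA : sorted ltn (map val (enum A)).
  rewrite /enum_mem (@sorted_map _ _ val) sorted_filter//.
    by move=> x y z; exact: ltn_trans.
  by rewrite -sorted_map -enumT val_enum_ord iota_ltn_sorted.
have szA := cardE A.
have x0 : 'I_n := enum_val i.
rewrite !(enum_val_nth x0) -!(nth_map _ (val x0) val) -?szA//.
by rewrite (sorted_ltn_nth ltn_trans)// inE size_map -szA.
Qed.

(** [pencil_rank] admits only increasing selections, so the independent rows chosen by [maxrankfun]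
    are listed again by enumerating their set. *)
Lemma exists_incr_row_free (F : fieldType) m n (M : 'M[F]_(m, n)) :
  exists2 f : 'I_(\rank M) -> 'I_m, incr_ord f & row_free (rowsub f M).
Proof.
pose A := [set maxrankfun M i | i : 'I_(\rank M)].
have cA : #|A| = \rank M.
  by rewrite card_imset ?card_ord//; exact: maxrankfun_inj.
suff : exists2 f : 'I_#|A| -> 'I_m, incr_ord f & \rank (rowsub f M) = #|A|.
  by rewrite cA => -[f fi /eqP ff]; exists f.
exists enum_val; first exact: incr_enum_val.
apply/eqP; rewrite eqn_leq rank_leq_row/= (leq_trans (eq_leq cA))//.
rewrite -{1}(eq_maxrowsub M); apply: mxrankS; apply/row_subP => i.
rewrite row_rowsub.
have Ai : maxrankfun M i \in A by apply: imset_f.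
by rewrite -(enum_rankK_in Ai Ai) -row_rowsub row_sub.
Qed.

Lemma exists_minor (F : fieldType) m n (M : 'M[F]_(m, n)) :
  exists (f : 'I_(\rank M) -> 'I_m) (g : 'I_(\rank M) -> 'I_n),
    [&& incr_ord f, incr_ord g & \det (mxsub f g M) != 0].
Proof.
have [f fi ff] := exists_incr_row_free M.
have := exists_incr_row_free (rowsub f M)^T; rewrite mxrank_tr (eqP ff).
move=> [g gi gf]; exists f, g; rewrite fi gi/=.
move: gf; rewrite row_free_unit -unitmx_tr unitmxE unitfE.
by congr (\det _ != 0); apply/matrixP => i j; rewrite !mxE.
Qed.

Lemma mxrank_mxsub (F : fieldType) m n p q (f : 'I_p -> 'I_m) (g : 'I_q -> 'I_n)
  (M : 'M[F]_(m, n)) : (\rank (mxsub f g M) <= \rank M)%N.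
Proof.
have -> : mxsub f g M = rowsub f 1%:M *m M *m colsub g 1%:M.
  by rewrite -{1}[M]mul1mx -{1}[1%:M *m M]mulmx1 mxsub_mul mxsub_mul mxsub_id.
exact: leq_trans (mxrankM_maxl _ _) (mxrankM_maxr _ _).
Qed.

Lemma continuous_det (K : numFieldType) (T : topologicalType) k
    (M : T -> 'M[K]_k) :
  (forall i j, continuous (fun x => M x i j)) ->
  continuous (fun x => \det (M x)).
Proof.
move=> Mc; rewrite /determinant; apply: continuous_big => [|s _].
  exact: add_continuous.
move=> x; apply: cvgM; first exact: cvg_cst.
by apply: cvg_big => [|i _]; [exact: mul_continuous | exact: Mc].
Qed.

Lemma closed_det_eq0 (K : numFieldType) (T : topologicalType) k
    (M : T -> 'M[K]_k) :
  (forall i j, continuous (fun x => M x i j)) ->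
  closed [set x | \det (M x) = 0].
Proof.
move=> /continuous_det/continuous_closedP Mc; apply: (Mc [set 0]).
apply: accessible_closed_set1; apply: hausdorff_accessible.
exact: norm_hausdorff.
Qed.

Lemma continuous_combination (K : numFieldType) (T : topologicalType) (mu : K)
  (f g : T -> K) : continuous f -> continuous g ->
  continuous (fun x => mu * f x - g x).
Proof.
move=> fc gc x; apply: cvgB; last exact: gc.
by apply: cvgM; [exact: cvg_cst | exact: fc].
Qed.

Definition pencil_at (R : realType) n (P : skew_pencil R n) (mu : R[i]) :
    'M[R[i]]_n :=
  mu *: (pencil_val P).1 - (pencil_val P).2.

Lemma pencil_at_minor (R : realType) n k (P : skew_pencil R n)
    (f g : 'I_k -> 'I_n) mu :
  (\det (mxsub f g (pencil_mx P))).[mu] = \det (mxsub f g (pencil_at P mu)).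
Proof.
rewrite -[LHS]/(horner_eval mu _) -det_map_mx; congr (\det _).
apply/matrixP => i j; rewrite !mxE /= /horner_eval hornerD hornerN hornerM.
by rewrite hornerX !hornerC.
Qed.

(** A minor that is a nonzero polynomial is nonzero at some [mu], and a minor nonzero at some [mu]
    is a nonzero polynomial. This reduces the rank of the pencil to ranks of scalar matrices. *)
Lemma pencil_rank_leP (R : realType) n (P : skew_pencil R n) r :
  (pencil_rank P <= r)%N <-> forall mu, (\rank (pencil_at P mu) <= r)%N.
Proof.
split=> [Pr mu|Pr].
  apply: leq_trans Pr.
  have [f [g /and3P[fi gi fg0]]] := exists_minor (pencil_at P mu).
  have rn : (\rank (pencil_at P mu) < n.+1)%N by rewrite ltnS rank_leq_row.
  apply: (@leq_bigmax_cond _ _ (fun k : 'I_n.+1 => k : nat) (Ordinal rn)).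
  apply/existsP; exists (finfun f); apply/existsP; exists (finfun g).
  have -> : mxsub (finfun f) (finfun g) (pencil_mx P) = mxsub f g (pencil_mx P).
    by apply/matrixP => i j; rewrite !mxE !ffunE.
  apply/and3P; split.
  - by apply/forallP => i; apply/forallP => j; rewrite !ffunE;
      move/forallP/(_ i)/forallP: fi.
  - by apply/forallP => i; apply/forallP => j; rewrite !ffunE;
      move/forallP/(_ i)/forallP: gi.
  - by apply: contraNneq fg0 => fg0; rewrite -pencil_at_minor fg0 horner0.
apply/bigmax_leqP => k /existsP[f /existsP[g /and3P[_ _]]].
move=> /closed_nonrootP[mu]; rewrite rootE pencil_at_minor => fg0.
apply: leq_trans (Pr mu); apply: leq_trans (mxrank_mxsub f g _).
by rewrite mxrank_unit// unitmxE unitfE.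
Qed.

Lemma normc_le_frobenius (R : realType) n (A : 'M[R[i]]_n) i j :
  Normc.normc (A i j) <= frobenius A.
Proof.
rewrite frobenius_pair -[leLHS]ger0_norm; last first.
  by case: (A i j) => a b; exact: sqrtr_ge0.
rewrite -sqrtr_sqr ler_wsqrtr// (bigD1 (i, j))//= lerDl sumr_ge0// => p _.
exact: sqr_ge0.
Qed.

Lemma normc_entry_le_dist (R : realType) n (P Q : skew_pencil R n) i j :
  Normc.normc ((pencil_val P).1 i j - (pencil_val Q).1 i j) <= pencil_dist P Q
  /\
  Normc.normc ((pencil_val P).2 i j - (pencil_val Q).2 i j) <= pencil_dist P Q.
Proof.
have sub (A B : 'M[R[i]]_n) : A i j - B i j = (A - B) i j by rewrite !mxE.
have [f1 f2] :
    frobenius ((pencil_val P).1 - (pencil_val Q).1) <= pencil_dist P Q /\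
    frobenius ((pencil_val P).2 - (pencil_val Q).2) <= pencil_dist P Q.
  by split; rewrite -[leLHS]ger0_norm ?frobenius_ge0// -sqrtr_sqr ler_wsqrtr//
    ?lerDl ?lerDr sqr_ge0.
by rewrite !sub; split; [apply: le_trans f1 | apply: le_trans f2];
  exact: normc_le_frobenius.
Qed.

(* [R[i]] carries its norm topology only when seen as a [numFieldType]. *)
Lemma continuous_pencil_at (R : realType) n (mu : R[i]) i j :
  continuous
    (fun P : skew_pencil R n => pencil_at P mu i j : (R[i] : numFieldType)).
Proof.
have ent (pr : skew_pencil R n -> 'M[R[i]]_n) :
    (forall P Q, Normc.normc (pr P i j - pr Q i j) <= pencil_dist P Q) ->
    continuous (fun P => pr P i j : (R[i] : numFieldType)).
  move=> prle P; have FP := nbhs_filter P.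
  apply/(@pseudometric_normed_Zmodule.cvgrPdist_lt _ _ _ _ FP) => e e0.
  (* A positive element of [R[i]] is real, so its real part can serve as radius. *)
  apply/nbhs_ballP; exists (complex.Re e) => /=.
    by move: e0; case: e => a b; rewrite ltcE => /andP[].
  move=> Q; rewrite ballEmdist /= => PQ; rewrite normc_def.
  move: e0 PQ; case: e => a b; rewrite ltcE /= => /andP[/eqP-> a0] PQ.
  rewrite ltcR; apply: le_lt_trans PQ; apply: le_trans (prle P Q).
  by case: (_ - _) => x y.
have c1 := ent (fun P => (pencil_val P).1)
  (fun P Q => (normc_entry_le_dist P Q i j).1).
have c2 := ent (fun P => (pencil_val P).2)
  (fun P Q => (normc_entry_le_dist P Q i j).2).
rewrite (_ : (fun P => _) = fun P : skew_pencil R n =>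
  (mu : (R[i] : numFieldType)) * (pencil_val P).1 i j - (pencil_val P).2 i j).
  exact: continuous_combination c1 c2.
by apply/funext => P; rewrite /pencil_at !mxE.
Qed.

(** The set is the intersection, over all [mu] and all selections of more than [r] rows and columns,
    of the zero sets of the minors at [mu]. *)
Lemma closed_pencil_rank_le (R : realType) n r :
  closed [set P : skew_pencil R n | (pencil_rank P <= r)%N].
Proof.
pose I := {k : nat & ('I_k -> 'I_n) * ('I_k -> 'I_n) * R[i]}%type.
pose Z (x : I) := [set P : skew_pencil R n |
  \det (mxsub (projT2 x).1.1 (projT2 x).1.2 (pencil_at P (projT2 x).2)) = 0].
rewrite (_ : mkset _ = \bigcap_(x in [set x : I | (r < projT1 x)%N]) Z x).
  apply: closed_bigI => -[k [[f g] mu]] _; rewrite /Z /=.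
  apply: (@closed_det_eq0 (R[i] : numFieldType)) => i j.
  under eq_fun do rewrite mxE; exact: continuous_pencil_at.
apply/seteqP; split=> P /=; rewrite pencil_rank_leP.
  move=> Pr [k [[f g] mu]] /= rk; rewrite /Z/=; apply: contraTeq rk => fg0.
  rewrite -leqNgt; apply: leq_trans (Pr mu).
  apply: leq_trans (mxrank_mxsub f g _).
  by rewrite mxrank_unit// unitmxE unitfE.
move=> PZ mu; rewrite leqNgt; apply/negP => rP.
have [f [g /and3P[_ _]]] := exists_minor (pencil_at P mu).
by have := PZ (existT _ _ ((f, g), mu)) rP; rewrite /Z/= => ->; rewrite eqxx.
Qed.

(** * The orbit closure *)

Lemma mxrank_corner_mx (F : fieldType) m n (K : 'M[F]_(m, n)) :
  (\rank (corner_mx K) <= 2 * m)%N.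
Proof.
rewrite /corner_mx -addsmxE mul2n -addnn.
apply: leq_trans (mxrank_adds_leqif _ _).1 _; rewrite leq_add ?rank_leq_row//.
by rewrite rank_row_mx0 rank_leq_col.
Qed.

Lemma rank_Wpencil_orbit (R : realType) n w (hw : (2 <= 2 * w <= n - 1)%N) :
  congruence_orbit (Wpencil R hw) `<=`
    [set P : skew_pencil R n | (pencil_rank P <= 2 * w)%N].
Proof.
have e : (w + (w + (n - 2 * w)) = n)%N by lia.
move=> Q [S _ QE] /=; apply/pencil_rank_leP => mu.
have [S' _ WE] := Wpencil_congr R hw e.
rewrite /pencil_at QE WE /= {hw WE QE}.
have congrB (X D1 D2 : 'M[R[i]]_n) : mu *: (X^T *m D1 *m X) - X^T *m D2 *m X =
    X^T *m (mu *: D1 - D2) *m X.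
  by rewrite mulmxBr mulmxBl -scalemxAr -scalemxAl.
rewrite !congrB.
have rk (X Y D : 'M[R[i]]_n) : (\rank (X *m D *m Y) <= \rank D)%N.
  exact: leq_trans (mxrankM_maxl _ _) (mxrankM_maxr _ _).
do 2!apply: leq_trans (rk _ _ _) _.
(* With [n - 2w] generalized to [d], [n] can be replaced by [w + (w + d)], and the casts
   disappear. *)
move: (n - 2 * w)%N e => d e; case: n / e {S S' Q rk congrB}.
rewrite !castmx_id; rewrite (_ : _ - _ =
  corner_mx (mu *: Gtrunc R[i] w d - Ftrunc R[i] w d)).
  exact: mxrank_corner_mx.
rewrite scale_block_mx opp_block_mx add_block_mx.
by congr block_mx; apply/matrixP => i j; rewrite !mxE; ring.
Qed.

Lemma frobeniusZ (R : realType) n (t : R[i]) (A : 'M[R[i]]_n) :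
  frobenius (t *: A) = Normc.normc t * frobenius A.
Proof.
have t0 : 0 <= Normc.normc t by case: t => ? ?; exact: sqrtr_ge0.
rewrite !frobenius_pair -[X in X * _]ger0_norm// -sqrtr_sqr -sqrtrM ?sqr_ge0//.
rewrite mulr_sumr; congr Num.sqrt; apply: eq_bigr => p _.
by rewrite mxE Normc.normcM exprMn.
Qed.

Lemma is_skew_pencil_line (R : realType) n (P : skew_pencil R n)
    (E1 E2 : 'M[R[i]]_n) t :
  E1^T = - E1 -> E2^T = - E2 ->
  is_skew_pencil ((pencil_val P).1 + t *: E1, (pencil_val P).2 + t *: E2).
Proof.
have /andP[/eqP A /eqP B] := pencil_valP P; move=> E1s E2s.
rewrite /is_skew_pencil /= !linearD !linearZ /= A B E1s E2s.
by rewrite !scalerN -!opprD !eqxx.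
Qed.

Lemma closure_of_generic_line (R : realType) n (O : set (skew_pencil R n))
    (P : skew_pencil R n) (E1 E2 : 'M[R[i]]_n) (q : {poly R[i]}) :
  E1^T = - E1 -> E2^T = - E2 -> q != 0 ->
  (forall t Q, q.[t] != 0 ->
    pencil_val Q = ((pencil_val P).1 + t *: E1, (pencil_val P).2 + t *: E2) ->
    O Q) -> closure O P.
Proof.
move=> E1s E2s q0 OQ B /nbhs_ballP[eps /= eps0 ballB].
have [s sE] := closed_field_poly_normal q.
pose c := Num.sqrt (frobenius E1 ^+ 2 + frobenius E2 ^+ 2).
have c0 : 0 <= c by exact: sqrtr_ge0.
(* The point is taken at [t = 1 / x], at distance [c / x < eps] from [P]. A real root [t] of [q]
   would put [x] among the excluded inverses. *)
have [|x xc xs] := @exists_notin R [seq (complex.Re z)^-1 | z <- s] (c / eps).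
  by rewrite divr_ge0// ltW.
have x0 : 0 < x by apply: le_lt_trans xc; rewrite divr_ge0// ltW.
pose t : R[i] := (x^-1)%:C.
have qt : q.[t] != 0.
  rewrite sE hornerZ mulf_eq0 lead_coef_eq0 (negPf q0)/= -/(root _ _).
  rewrite root_prod_XsubC; apply: contra xs => ts.
  by apply/mapP; exists t => //=; rewrite invrK.
pose Q := SkewPencil (is_skew_pencil_line P t E1s E2s).
exists Q; split; first exact: (OQ t).
apply: ballB; rewrite ballEmdist /=.
have subE (A E : 'M[R[i]]_n) :
    frobenius (A - (A + t *: E)) = x^-1 * frobenius E.
  rewrite opprD addrA subrr sub0r frobeniusN frobeniusZ; congr (_ * _).
  by rewrite /= expr0n addr0 sqrtr_sqr ger0_norm// invr_ge0 ltW.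
have -> : mdist P Q = x^-1 * c.
  rewrite -[LHS]/(pencil_dist P Q) /pencil_dist !subE !exprMn -mulrDr.
  rewrite sqrtrM ?sqr_ge0// sqrtr_sqr ger0_norm// invr_ge0 ltW//.
by rewrite mulrC ltr_pdivrMr// mulrC -ltr_pdivrMr.
Qed.

Lemma cast_skew_rank_generic_line (R : realType) n w d (e : (w + (w + d))%N = n)
    (A B : 'M[R[i]]_n) :
  (0 < d)%N -> A^T = - A -> B^T = - B ->
  (forall mu, (\rank (mu *: A - B)%R <= 2 * w)%N) ->
  exists E1 E2 : 'M[R[i]]_n, [/\ E1^T = - E1, E2^T = - E2 &
  exists2 q : {poly R[i]}, q != 0 & forall t, q.[t] != 0 ->
    exists2 S, S \in unitmx &
      A + t *: E1 = S^T *m castmx (e, e) (corner_mx (Gtrunc R[i] w d)) *m S /\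
      B + t *: E2 = S^T *m castmx (e, e) (corner_mx (Ftrunc R[i] w d)) *m S].
Proof.
by case: n / e A B => A B; rewrite !castmx_id; exact: skew_rank_generic_line.
Qed.

Lemma rank_le_closure_orbit (R : realType) n w (hw : (2 <= 2 * w <= n - 1)%N) :
  [set P : skew_pencil R n | (pencil_rank P <= 2 * w)%N] `<=`
    closure (congruence_orbit (Wpencil R hw)).
Proof.
have e : (w + (w + (n - 2 * w)) = n)%N by lia.
have d0 : (0 < n - 2 * w)%N by lia.
move=> P /= /pencil_rank_leP Pr.
have /andP[/eqP Ask /eqP Bsk] := pencil_valP P.
have [E1 [E2 [E1s E2s [q q0 qP]]]] :=
  cast_skew_rank_generic_line e d0 Ask Bsk Pr.
have [S' S'u WE] := Wpencil_congr R hw e.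
apply: (closure_of_generic_line E1s E2s q0) => t Q qt QE.
have [S Su [S1 S2]] := qP t qt.
(* [S'] leads from the corner form to [W] and [S] from the corner form to [Q]; the witness passes
   through the corner form. *)
exists (invmx S' *m S); first by rewrite unitmx_mul unitmx_inv S'u.
have cancelS N : (invmx S' *m S)^T *m (S'^T *m N *m S') *m (invmx S' *m S) =
    S^T *m N *m S.
  have SV : (invmx S')^T *m S'^T = 1%:M by rewrite -trmx_mul mulmxV// trmx1.
  rewrite trmx_mul !mulmxA -(mulmxA S^T (invmx S')^T) SV mulmx1.
  by rewrite -(mulmxA _ S') mulmxV// mulmx1.
by rewrite QE WE S1 S2 /= !cancelS.
Qed.

Theorem theorem3p1 (R : realType) (n w : nat) (hn : (2 <= n)%N)
    (hw : (2 <= 2 * w <= n - 1)%N) :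
  closed [set P : skew_pencil R n | (pencil_rank P <= 2 * w)%N] /\
  [set P : skew_pencil R n | (pencil_rank P <= 2 * w)%N] =
    closure (congruence_orbit (Wpencil R hw)).
Proof.
have closedZ := @closed_pencil_rank_le R n (2 * w); split=> //.
apply/seteqP; split; first exact: rank_le_closure_orbit.
rewrite [X in _ `<=` X](closure_id _).1//; apply: closure_subset.
exact: rank_Wpencil_orbit.
Qed.
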